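(* Let $\mathcal{D} = \{d_k\}_{k \geq 1}$ be a sequence of integers, each greater than or equal to $2$, and set $t_0 = 1$ and $t_n = \prod_{k=1}^n d_k$ for $n \geq 1$. Let $$A = \Big\{ \alpha \in \mathbf{Bad} : \inf_{n \geq 1} q_n(\alpha)\cdot |q_n(\alpha)|_{\mathcal{D}} \cdot \|q_n(\alpha)\alpha\| > 0 \ \text{ and } \ \inf_{n \geq 1} t_n \cdot |t_n|_{\mathcal{D}} \cdot \|t_n\alpha\| > 0 \Big\}.$$ Then $A$ is $1/2$-winning, and in particular $\dim_H A = 1$.
   Context: For real $t$, $\|t\|$ denotes the distance from $t$ to the nearest integer. $\mathbf{Bad} = \{ \alpha \in \mathbb{R} : \exists\, c(\alpha) > 0 \text{ such that } \|q\alpha\| > c(\alpha) q^{-1} \text{ for all integers } q \geq 1 \}$ (all such numbers are irrational). For an irrational real $\alpha$ with regular continued fraction expansion $\alpha = [a_0; a_1, a_2, \ldots]$, $q_n(\alpha)$ denotes the (positive) denominator, in lowest terms, of its $n$-th convergent $[a_0; a_1, \ldots, a_n]$. $\dim_H$ denotes Hausdorff dimension. For a positive integer $q$, let $\omega_{\mathcal{D}}(q) = \sup\{n \geq 0 : q \in t_n \mathbb{Z}\}$ and $|q|_{\mathcal{D}} = \frac{1}{t_{\omega_{\mathcal{D}}(q)}} = \inf\{\frac{1}{t_n} : n \geq 0,\ q \in t_n\mathbb{Z}\}$. Schmidt games: for given $\alpha, \beta \in (0,1)$, two players $A$ and $B$ play as follows (the player $A$ is not to be confused with the set $A$). First $B$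 chooses a closed interval $B_0 \subset \mathbb{R}$ with length $|B_0| = \beta$. After $B_n$ has been chosen, $A$ chooses a closed interval $A_n \subset B_n$ with $|A_n| = \alpha |B_n|$; then $B$ chooses a closed interval $B_{n+1} \subset A_n$ with $|B_{n+1}| = \beta |A_n|$. The intersection $\bigcap_{n=0}^\infty A_n = \bigcap_{n=0}^\infty B_n$ is a single point. A set $Y \subset \mathbb{R}$ is $(\alpha,\beta)$-winning if $A$ can play so that the point of $\bigcap_{n=0}^\infty A_n$ belongs to $Y$, regardless of how $B$ plays. A set $Y$ is $\alpha$-winning if it is $(\alpha,\beta)$-winning for all $\beta \in (0,1)$. *)

(* Defs.v *)
From mathcomp Require Import all_boot all_order all_algebra.
From mathcomp Require Import all_classical all_reals all_analysis.

Set Implicit Arguments.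
Unset Strict Implicit.
Unset Printing Implicit Defensive.

Import Order.TTheory GRing.Theory Num.Theory.

Local Open Scope classical_set_scope.
Local Open Scope ring_scope.

Definition dist_int (R : realType) (x : R) : R :=
  inf [set `|x - m%:~R| | m in [set: int]].

Definition Bad (R : realType) : set R :=
  [set x | exists2 c : R, 0 < c &
     forall q : nat, (1 <= q)%N -> c * q%:R^-1 < dist_int (q%:R * x)].

(* The n-th partial quotient of the regular continued fraction expansion;
   only meaningful when the expansion does not stop before rank n (in
   particular for every n when x is irrational). *)
Definition cf_quot (R : realType) (x : R) (n : nat) : int :=
  Num.floor (iter n (fun y : R => (y - (Num.floor y)%:~R)^-1) x).

(* [a 0; a 1, ..., a n] *)
Fixpoint cf_eval (a : nat -> int) (n : nat) : rat :=
  if n is n'.+1 then (a 0%N)%:~R + (cf_eval (fun k => a k.+1) n')^-1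
  else (a 0%N)%:~R.

Definition cf_denom (R : realType) (x : R) (n : nat) : nat :=
  `|denq (cf_eval (cf_quot x) n)|%N.

(* The sequence d is indexed from 1: the value d 0 is never used. *)
Definition tD (d : nat -> nat) (n : nat) : nat :=
  (\prod_(1 <= k < n.+1) d k)%N.

Definition absD (R : realType) (d : nat -> nat) (q : nat) : R :=
  inf [set (tD d n)%:R^-1 | n in [set n : nat | (tD d n %| q)%N]].

Definition mixedBad (R : realType) (d : nat -> nat) : set R :=
  [set x | [/\ Bad x,
    0 < inf [set (cf_denom x n)%:R * absD R d (cf_denom x n)
                   * dist_int ((cf_denom x n)%:R * x)
            | n in [set n : nat | (1 <= n)%N]] &
    0 < inf [set (tD d n)%:R * absD R d (tD d n) * dist_int ((tD d n)%:R * x)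
            | n in [set n : nat | (1 <= n)%N]]]].

(* In the games below a closed interval is given by its pair of endpoints.
   All lengths occurring in a legal play are positive. *)
Definition itvset (R : realType) (I : R * R) : set R := `[I.1, I.2]%classic.

Definition itvlen (R : realType) (I : R * R) : R := I.2 - I.1.

Definition legalB (R : realType) (beta : R) (As Bs : nat -> R * R) (n : nat) :
    Prop :=
  if n is n'.+1 then
    itvset (Bs n) `<=` itvset (As n') /\ itvlen (Bs n) = beta * itvlen (As n')
  else itvlen (Bs 0%N) = beta.

Definition legalA (R : realType) (alpha : R) (As Bs : nat -> R * R) (n : nat) :
    Prop :=
  itvset (As n) `<=` itvset (Bs n) /\ itvlen (As n) = alpha * itvlen (Bs n).

(* A strategy of player A maps the moves B_0, ..., B_n of player B so far to
   A_n. A winning one must answer legally as long as B has played legally. *)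
Definition winning2 (R : realType) (alpha beta : R) (Y : set R) : Prop :=
  exists s : seq (R * R) -> R * R,
    forall Bs : nat -> R * R,
    let As := fun n => s (mkseq Bs n.+1) in
    (forall n, (forall m, (m <= n)%N -> legalB beta As Bs m) ->
       legalA alpha As Bs n) /\
    ((forall n, legalB beta As Bs n) ->
       exists2 x : R, \bigcap_n itvset (As n) = [set x] & Y x).

Definition winning (R : realType) (alpha : R) (Y : set R) : Prop :=
  forall beta : R, 0 < beta < 1 -> winning2 alpha beta Y.

(* Adjoining 0 gives the empty set diameter 0 (ereal_sup set0 is -oo). *)
Definition diam (R : realType) (U : set R) : \bar R :=
  ereal_sup (0%E |` [set `|x.1 - x.2|%:E | x in U `*` U]).

(* The empty set contributes 0 even when s = 0, where 0 `^ 0 = 1. *)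
Definition diam_pow (R : realType) (s : R) (U : set R) : \bar R :=
  if U == set0 then 0%E else (diam U `^ s)%E.

Definition hausdorff_delta (R : realType) (s delta : R) (E : set R) :
    \bar R :=
  ereal_inf [set (\sum_(0 <= k <oo) diam_pow s (U k))%E
    | U in [set U : nat -> set R | E `<=` \bigcup_k U k /\
                                   forall k, (diam (U k) <= delta%:E)%E]].

Definition hausdorff_measure (R : realType) (s : R) (E : set R) : \bar R :=
  ereal_sup [set hausdorff_delta s delta E
    | delta in [set delta : R | 0 < delta]].

Definition hausdorff_dim (R : realType) (E : set R) : \bar R :=
  ereal_inf [set s%:E
    | s in [set s : R | 0 <= s /\ hausdorff_measure s E = 0%E]].

(* Main.v *)
Require Import Defs.
From mathcomp Require Import all_boot all_order all_algebra.
From mathcomp Require Import all_classical all_reals all_analysis.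
From mathcomp Require Import ring lra zify.
Import Order.TTheory GRing.Theory Num.Theory.
Local Open Scope classical_set_scope.
Local Open Scope ring_scope.

(** Player [A] wins by keeping the outcome [x] of the game away from three
    families of rational numbers: all fractions [p / q], at distance of order
    [1 / q ^+ 2]; the fractions [p / t_n], at distance of order [1 / t_n]; and
    the fractions [p / q] with [t_M] dividing [q], at distance of order
    [t_M / q ^+ 2], for one suitable [M] ([mixedBad_of_avoid]). The first
    family gives [Bad]. The second gives the last condition, since
    [t_n * |t_n| = 1]. If [t_M] is large enough, the third one puts [x] at
    distance at least [1 / q ^+ 2] from [p / q] whenever [t_M] divides [q], so
    that no such [q] is the denominator of a convergent
    ([cf_denom_approx]); hence [|q_n| >= 1 / t_M] for all [n], and the
    condition on the [q_n] reduces to [Bad].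

    These families have a common feature, which makes them avoidable at once
    ([winning2_avoid_well_spaced]): give each point a height [H], namely
    [q ^+ 2], [t_n] and [q ^+ 2 / t_M] respectively; then distinct points of
    one family with heights at most [H] are at least [1 / H] apart. For the
    second family this holds because the [t_n] divide one another, for the
    third one because the difference of two such fractions has a numerator
    divisible by [t_M]. So an interval of length [1 / H] contains in its
    interior at most one point of height at most [H], and [A] can get away
    from it in three rounds by choosing suitable halves
    ([winning2_avoid_separated]). The families are dealt with in turn. The
    constant obtained does not depend on the families, which allows [M] to be
    chosen after it.

    Any winning set has positive Hausdorff measure in each exponent [s < 1]
    ([winning_hausdorff_measure]): with [beta = 1 / (2 * N)], player [B] has [N]
    well separated moves in each round, so that the outcomes contain a Cantor
    set with [N] branches and contraction ratio [alpha / (2 * N)]. Its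
    dimension tends to 1 with [N]. The measure is bounded from below by
    reading the branches as base [N] digits of the points of the unit interval
    and using the subadditivity of length there ([hausdorff_measure_holder]). *)

Set Implicit Arguments.
Unset Strict Implicit.
Unset Printing Implicit Defensive.

(** * Plays of the game *)

Lemma itvset_subP (R : realType) {I J : R * R} : I.1 <= I.2 ->
  itvset I `<=` itvset J <-> J.1 <= I.1 /\ I.2 <= J.2.
Proof.
move=> I12; split=> [IJ|[J1 J2] x]; rewrite /itvset /=.
  have := IJ I.1; have := IJ I.2; rewrite /itvset /= !in_itv /= !lexx !I12.
  by move=> /(_ isT)/andP[_ ->] /(_ isT)/andP[->].
rewrite !in_itv /= => /andP[x1 x2].
by rewrite (le_trans J1 x1) (le_trans x2 J2).
Qed.

Lemma exp_lt_eps (R : realType) (c r e : R) : 0 <= r < 1 -> 0 < e ->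
  exists n, c * r ^+ n < e.
Proof.
move=> /andP[r0 r1] e0; have rn : `|r| < 1 by rewrite ger0_norm.
have /cvgr0_norm_lt/(_ _ e0) := cvg_geometric c rn.
move=> [n _ /(_ n (leqnn n))] /= H.
by exists n; rewrite (le_lt_trans (ler_norm _)).
Qed.

Lemma nested_itv_point (R : realType) (As : nat -> R * R) (c r : R) :
  0 <= r < 1 -> (forall n, (As n).1 <= (As n).2) ->
  (forall n, itvset (As n.+1) `<=` itvset (As n)) ->
  (forall n, itvlen (As n) <= c * r ^+ n) ->
  exists x, \bigcap_n itvset (As n) = [set x].
Proof.
move=> r01 A12 Asub Alen.
have sub m n : (m <= n)%N -> itvset (As n) `<=` itvset (As m).
  elim: n => [|n IH]; first by rewrite leqn0 => /eqP ->.
  rewrite leq_eqVlt => /predU1P[->//|mn].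
  by apply: subset_trans (IH mn); exact: Asub.
have lr m n : (As m).1 <= (As n).2.
  have /(itvset_subP (A12 _))[h1 _] := @sub m (maxn m n) (leq_maxl _ _).
  have /(itvset_subP (A12 _))[_ h2] := @sub n (maxn m n) (leq_maxr _ _).
  exact: le_trans h1 (le_trans (A12 _) h2).
pose E := range (fun n => (As n).1).
have supE : has_sup E.
  by split; [exists (As 0%N).1, 0%N|exists (As 0%N).2 => _ [m _ <-]].
have xA n : itvset (As n) (sup E).
  rewrite /itvset /= in_itv /=; apply/andP; split.
    by apply: ub_le_sup; [exact: supE.2|exists n].
  by apply: ge_sup; [exact: supE.1|move=> _ [m _ <-]].
exists (sup E); apply/seteqP; split=> [y yA|_ ->] //=.
apply/eqP; rewrite -subr_eq0 -normr_eq0 eq_le normr_ge0 andbT leNgt.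
apply/negP => /(exp_lt_eps c r01)[n].
apply/negP; rewrite -leNgt; apply: le_trans (Alen n).
move: (xA n) (yA n I); rewrite /itvset /itvlen /= !in_itv /=.
by move=> /andP[? ?] /andP[? ?]; rewrite ler_norml; lra.
Qed.

Section Play.
Variables (R : realType) (alpha beta : R) (As Bs : nat -> R * R).
Hypotheses (al : 0 < alpha < 1) (be : 0 < beta < 1).

Lemma play_len n : (forall m, (m <= n)%N -> legalB beta As Bs m) ->
  (forall m, (m < n)%N -> legalA alpha As Bs m) ->
  itvlen (Bs n) = beta * (alpha * beta) ^+ n.
Proof.
elim: n => [|n IH] lB lA; first by rewrite expr0 mulr1; exact: (lB 0%N).
rewrite (lB n.+1 (leqnn _)).2 (lA n (leqnn _)).2 IH ?exprS; first by ring.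
  by move=> m mn; apply: lB; exact: leqW.
by move=> m mn; apply: lA; exact: leqW.
Qed.

Hypotheses (lB : forall n, legalB beta As Bs n).
Hypotheses (lA : forall n, legalA alpha As Bs n).

Lemma play_lenB n : itvlen (Bs n) = beta * (alpha * beta) ^+ n.
Proof. by apply: play_len => m _; [exact: lB|exact: lA]. Qed.

Lemma play_lenA n : itvlen (As n) = alpha * beta * (alpha * beta) ^+ n.
Proof. by rewrite (lA n).2 play_lenB mulrA. Qed.

Let be0 : 0 < beta. Proof. by case/andP: be. Qed.
Let ab0 : 0 < alpha * beta.
Proof. by case/andP: al => a0 _; rewrite mulr_gt0. Qed.

Lemma play_lenB_gt0 n : 0 < itvlen (Bs n).
Proof. by rewrite play_lenB mulr_gt0 // exprn_gt0. Qed.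

Lemma play_lenA_gt0 n : 0 < itvlen (As n).
Proof. by rewrite play_lenA mulr_gt0 // exprn_gt0. Qed.

Lemma play_A_le n : (As n).1 <= (As n).2.
Proof. by have := play_lenA_gt0 n; rewrite /itvlen; lra. Qed.

Lemma play_B_le n : (Bs n).1 <= (Bs n).2.
Proof. by have := play_lenB_gt0 n; rewrite /itvlen; lra. Qed.

Lemma play_BA n : (As n).1 <= (Bs n.+1).1 /\ (Bs n.+1).2 <= (As n).2.
Proof. by apply/itvset_subP; [exact: play_B_le|exact: (lB n.+1).1]. Qed.

Lemma play_point : exists x, \bigcap_n itvset (As n) = [set x].
Proof.
apply: (@nested_itv_point _ _ (alpha * beta) (alpha * beta)).
- by move: al be => /andP[? ?] /andP[? ?]; rewrite ltW //= mulr_ilt1 // ltW.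
- exact: play_A_le.
- by move=> n; apply: subset_trans (lA _).1 (lB n.+1).1.
- by move=> n; rewrite play_lenA.
Qed.

End Play.

Lemma winning2_sub (R : realType) (alpha beta : R) (Y Z : set R) : Y `<=` Z ->
  winning2 alpha beta Y -> winning2 alpha beta Z.
Proof.
move=> YZ [s hs]; exists s => Bs; have [h1 h2] := hs Bs.
split=> // /h2[x xA Yx]; exists x => //; exact: YZ.
Qed.

(** * Avoiding separated points *)

Definition left_half {R : realType} (I : R * R) : R * R :=
  (I.1, (I.1 + I.2) / 2).

Definition right_half {R : realType} (I : R * R) : R * R :=
  ((I.1 + I.2) / 2, I.2).

(** When [A] halves, [B_n] has length [beta * (beta / 2) ^+ n]; a stage of
    three rounds is used per set of points to avoid, so that this is the
    length of the interval [B_(3 k)] with which stage [k] starts. *)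
Definition stage_len {R : realType} (beta : R) (k : nat) : R :=
  beta * (beta / 2) ^+ (3 * k).

Section Avoid.
Variables (R : realType) (beta : R) (P : nat -> set R).
Hypothesis be : 0 < beta < 1.
Hypothesis Psep : forall k p p', P k p -> P k p' -> p != p' ->
  stage_len beta k <= `|p - p'|.

(** The reply depends on the round and on the last move of [B] only. In the
    first round of a stage it is a half with no point of [P k] in its
    interior. The points of [P k] may still be endpoints of that half; the
    next two rounds leave first its right end and then its left end. *)
Definition dodge_half (n : nat) (I : R * R) : R * R :=
  match (n %% 3)%N with
  | 0 => if `[< exists p, P (n %/ 3) p /\ I.1 < p < (I.1 + I.2) / 2 >]
         then right_half I else left_half I
  | 1 => left_half I
  | _ => right_half I
  end.

Definition dodge (h : seq (R * R)) : R * R :=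
  dodge_half (size h).-1 (last (0, 0) h).

Lemma dodgeE (Bs : nat -> R * R) n : dodge (mkseq Bs n.+1) = dodge_half n (Bs n).
Proof. by rewrite /dodge size_mkseq mkseqS last_rcons. Qed.

Lemma dodge_half_sub n (I : R * R) : I.1 <= I.2 ->
  itvset (dodge_half n I) `<=` itvset I.
Proof.
move=> I12; apply/itvset_subP; rewrite /dodge_half /left_half /right_half;
  case: (n %% 3)%N => [|[|?]] //=; try case: ifP => _ /=; lra.
Qed.

Lemma dodge_half_len n (I : R * R) :
  itvlen (dodge_half n I) = 2^-1 * itvlen I.
Proof.
rewrite /dodge_half /left_half /right_half /itvlen.
case: (n %% 3)%N => [|[|?]] //=; try case: ifP => _ /=; lra.
Qed.

(** Two points of [P k] inside an interval of length [stage_len beta k] would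
    be too close to each other, so that a half without them exists. *)
Lemma dodge_half_interior k (I : R * R) p : itvlen I = stage_len beta k ->
  P k p ->
  p <= (dodge_half (3 * k) I).1 \/ (dodge_half (3 * k) I).2 <= p.
Proof.
move=> lenI Pp; rewrite /dodge_half modnMr mulKn //.
case: ifP => [/asboolP[q [Pq /andP[q1 q2]]]|/asboolPn nP] /=.
  case: (leP p ((I.1 + I.2) / 2)) => pm; first by left.
  right; rewrite leNgt; apply/negP => pI.
  have := Psep Pp Pq _; rewrite gt_eqF ?(lt_trans q2) // => /(_ isT).
  by rewrite -lenI /itvlen ger0_norm; lra.
case: (leP p I.1) => pI; first by left.
right; rewrite leNgt; apply/negP => pm; apply: nP.
by exists p; split=> //; rewrite pI.
Qed.

Let shrink n : 0 < beta * (2^-1 * beta) ^+ n /\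
  beta * (2^-1 * beta) ^+ n.+1 <= 2^-1 * (beta * (2^-1 * beta) ^+ n).
Proof.
case/andP: be => b0 b1; have L0 : 0 < beta * (2^-1 * beta) ^+ n.
  by rewrite mulr_gt0 // exprn_gt0 // mulr_gt0 //; lra.
split=> //; rewrite exprS; set t := _ ^+ n in L0 *.
have -> : beta * (2^-1 * beta * t) = beta * (2^-1 * (beta * t)) by ring.
by rewrite ler_piMl ?ltW //; lra.
Qed.

(** After the first round of stage [k], a point [p] of [P k] is not interior
    to [A_(3 k)]. If [p] lies on its right, then the left half taken next
    stays away from [p] by half the length of [B_(3 k + 1)]; if it lies on its
    left, the right half taken in the last round stays away from [p] by half
    the length of [B_(3 k + 2)]. Both are at least the length of the interval
    with which the next stage starts. *)
Lemma winning2_avoid_separated :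
  winning2 2^-1 beta
    [set x | forall k p, P k p -> stage_len beta k.+1 <= `|x - p|].
Proof.
have al : 0 < (2^-1 : R) < 1 by apply/andP; split; lra.
exists dodge => Bs As.
have lA n : (forall m, (m <= n)%N -> legalB beta As Bs m) ->
    legalA 2^-1 As Bs n.
  elim/ltn_ind: n => n IH lB; rewrite /As /legalA dodgeE dodge_half_len.
  split=> //; apply: dodge_half_sub.
  suff : 0 < itvlen (Bs n) by rewrite /itvlen; lra.
  rewrite (play_len (alpha := 2^-1) (beta := beta) (As := As)) //.
    exact: (shrink n).1.
  by move=> m mn; apply: IH => // j jm; apply: lB; apply: leq_trans (ltnW mn).
split=> // lB; have {}lA n : legalA 2^-1 As Bs n by apply: lA.
have [x xE] := play_point al be lB lA; exists x => // k p Pp.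
have xA n : itvset (As n) x by have : [set x] x by []; rewrite -xE; apply.
have := xA (3 * k).+2; rewrite /itvset /= in_itv /=.
have [AB1 AB2] := play_BA al be lB lA (3 * k).
have [AB3 AB4] := play_BA al be lB lA (3 * k).+1.
have lenB0 : itvlen (Bs (3 * k)%N) = stage_len beta k.
  by rewrite (play_lenB lB lA) /stage_len [beta / 2]mulrC.
have := dodge_half_interior lenB0 Pp; rewrite -dodgeE -/(As _).
have -> : As (3 * k).+2 = right_half (Bs (3 * k).+2).
  by rewrite /As dodgeE /dodge_half -addn2 mulnC modnMDl.
have E1 : As (3 * k).+1 = left_half (Bs (3 * k).+1).
  by rewrite /As dodgeE /dodge_half -addn1 mulnC modnMDl.
move: AB3 AB4; rewrite E1 /left_half /right_half /= => AB3 AB4.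
have := play_lenB lB lA (3 * k).+1; have := play_lenB lB lA (3 * k).+2.
rewrite /itvlen /stage_len mulnS [beta / 2]mulrC -[(3 + 3 * k)%N]/(3 * k).+3.
have := shrink (3 * k).+1; have := shrink (3 * k).+2.
by case=> ? ? [? ?] ? ? [?|?] /andP[? ?];
  [rewrite ger0_norm; lra|rewrite ler0_norm; lra].
Qed.

End Avoid.

(** * Avoiding several families of points with heights *)

(** A pair [u] stands for a point [u.1] with a height [u.2], from which the
    distance should be kept of order [1 / u.2]. The spacing condition says
    that the points of height at most [H] are at least [1 / H] apart. *)
Definition well_spaced {R : realType} (F : set (R * R)) : Prop :=
  (forall u, F u -> 1 <= u.2) /\
  (forall u v, F u -> F v -> u.1 != v.1 ->
     1 <= Num.max u.2 v.2 * `|u.1 - v.1|).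

(** With [N] families handled in turn, the length drops by the factor
    [(beta / 2) ^+ (3 * N.+1)] during a turn and the stage that follows it;
    the additional factor [beta], the initial length, accounts for the points
    handled during the first turn. *)
Definition avoid_const {R : realType} (beta : R) (N : nat) : R :=
  stage_len beta N.+1.

Lemma stage_len_gt0 (R : realType) (beta : R) k : 0 < beta < 1 ->
  0 < stage_len beta k.
Proof. by case/andP=> b0 b1; rewrite mulr_gt0 // exprn_gt0 //; lra. Qed.

Lemma stage_len_le (R : realType) (beta : R) k l : 0 < beta < 1 ->
  (k <= l)%N -> stage_len beta l <= stage_len beta k.
Proof.
case/andP=> b0 b1 kl; rewrite ler_pM2l // ler_wiXn2l ?leq_mul2l //; lra.
Qed.

(** Take the first of the stages devoted to family [j] whose initial length is
    at most [1 / H]: unless it is the very first one, the preceding stage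
    devoted to this family, [N] stages earlier, was longer than [1 / H]. *)
Lemma stage_len_scale (R : realType) (beta H : R) (N j : nat) :
  0 < beta < 1 -> (j < N)%N -> 1 <= H ->
  exists k, [/\ (k %% N)%N = j, H * stage_len beta k <= 1 &
                avoid_const beta N <= H * stage_len beta k.+1].
Proof.
move=> be jN H1; have N0 : (0 < N)%N by apply: leq_ltn_trans jN.
have [b0 b1] := andP be.
have small : exists i, H * stage_len beta (i * N + j) <= 1.
  have [|n nlt] := @exp_lt_eps _ (H * beta) (beta / 2) 1 _ ltr01.
    by apply/andP; split; lra.
  exists n; apply: le_trans (ltW nlt); rewrite /stage_len -mulrA.
  rewrite ler_wpM2l ?(le_trans ler01) // ler_wpM2l ?(ltW b0) //.
  by rewrite ler_wiXn2l //; [lra|lra|nia].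
case: (ex_minnP small) => i Hi imin; exists (i * N + j)%N; split=> //.
  by rewrite modnMDl modn_small.
case: i => [|i] in Hi imin *.
  rewrite mul0n add0n -[leLHS]mul1r ler_pM ?ler01 //; first by apply/ltW/stage_len_gt0.
  by apply: stage_len_le => //; exact: ltnW.
have : 1 < H * stage_len beta (i * N + j).
  by rewrite ltNge; apply/negP => /imin; rewrite ltnn.
have -> : stage_len beta (i.+1 * N + j).+1 =
    stage_len beta (i * N + j) * (beta / 2) ^+ (3 * N.+1).
  rewrite /stage_len -mulrA -exprD -mulnDr; congr (_ * _ ^+ (3 * _)); lia.
rewrite /avoid_const {2}/stage_len mulrA => /ltW h.
by rewrite ler_pM ?exprn_ge0 //; lra.
Qed.

(** The constant depends on [beta] and on the number of families only, not on
    the families: this makes it possible to choose one of them in terms of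
    the constant. *)
Lemma winning2_avoid_well_spaced (R : realType) (beta : R) (N : nat)
    (F : nat -> set (R * R)) :
  0 < beta < 1 -> (forall i, (i < N)%N -> well_spaced (F i)) ->
  winning2 2^-1 beta
    [set x | forall i u, (i < N)%N -> F i u ->
       avoid_const beta N <= u.2 * `|x - u.1|].
Proof.
move=> be Fsp.
(* stage k deals with the points of family k %% N that its length separates *)
pose P k : set R := [set p | exists u, [/\ (k %% N < N)%N, F (k %% N)%N u,
  u.2 * stage_len beta k <= 1 & u.1 = p]].
have Psep k p p' : P k p -> P k p' -> p != p' ->
    stage_len beta k <= `|p - p'|.
  move=> [u [kN Fu uk <-]] [v [_ Fv vk <-]] uv.
  have := (Fsp _ kN).2 u v Fu Fv uv; set m := Num.max _ _.
  have mk : m * stage_len beta k <= 1 by rewrite /m; case: (leP u.2 v.2).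
  have L0 := stage_len_gt0 k be; move=> h; have m0 : 0 < m.
    by rewrite /m lt_max (lt_le_trans ltr01) // (Fsp _ kN).1.
  by rewrite -(ler_pM2l m0); exact: le_trans mk h.
apply: winning2_sub (winning2_avoid_separated be Psep).
move=> x xP i u iN Fu; have u1 := (Fsp i iN).1 u Fu.
have [k [kN k1 ck]] := stage_len_scale be iN u1.
apply: le_trans ck _; rewrite ler_pM2l ?(lt_le_trans ltr01) //.
by apply: xP; exists u; rewrite kN.
Qed.

(** * Convergents *)

Definition irrational {R : realType} (x : R) : Prop :=
  forall p q : int, q != 0 -> q%:~R * x != p%:~R.

Definition gauss_step {R : realType} (x : R) : R :=
  (x - (Num.floor x)%:~R)^-1.

Lemma frac_part_neq0 (R : realType) (x : R) : irrational x ->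
  x - (Num.floor x)%:~R != 0.
Proof. by move=> /(_ (Num.floor x) 1 isT); rewrite mul1r subr_eq0. Qed.

Lemma irrational_gauss_step (R : realType) (x : R) : irrational x ->
  irrational (gauss_step x).
Proof.
move=> xirr p q q0; set a := Num.floor x; apply/eqP => E.
have xa : x - a%:~R != 0 by exact: frac_part_neq0.
have qE : q%:~R = p%:~R * (x - a%:~R) by rewrite -E -mulrA mulVf ?mulr1.
have p0 : p != 0.
  by apply: contraNneq q0 => p0; rewrite p0 mul0r in qE; rewrite -(intr_eq0 R) qE.
have /eqP[] := xirr (q + p * a) p p0.
by rewrite intrD qE intrM; ring.
Qed.

Lemma gauss_step_gt1 (R : realType) (x : R) : irrational x -> 1 < gauss_step x.
Proof.
move=> xirr; set a := Num.floor x.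
have := floor_itv x; rewrite -/a intrD => /andP[x1 x2].
have xa : x - a%:~R != 0 by exact: frac_part_neq0.
have x0 : 0 < x - a%:~R by rewrite lt_def xa subr_ge0.
by rewrite /gauss_step invf_gt1 // -/a; lra.
Qed.

Lemma cf_quotS (R : realType) (x : R) :
  (fun k => cf_quot x k.+1) = cf_quot (gauss_step x).
Proof. by apply/funext => k; rewrite /cf_quot iterSr. Qed.

(** Here [p / q] and [p' / q'] are the convergents of ranks [n] and [n - 1]
    and [z] is the complete quotient of rank [n + 1]. The induction goes
    through the tail [gauss_step x], for which the new denominators [p] and
    [p'] are nonnegative because it exceeds 1; this is what the last
    conclusion records. *)
Lemma cf_eval_moebius (R : realType) (x : R) n : irrational x ->
  exists (z : R) (p q p' q' : int),
    [/\ 1 < z /\ x * (q%:~R * z + q'%:~R) = p%:~R * z + p'%:~R,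
        0 < q /\ 0 <= q',
        `|p * q' - p' * q| = 1,
        cf_eval (cf_quot x) n = p%:~R / q%:~R &
        1 <= x -> 0 < p /\ 0 <= p'].
Proof.
elim: n x => [|n IH] x xirr; set a := Num.floor x.
  exists (gauss_step x), a, 1, 1, 0; split.
  - split; first exact: gauss_step_gt1.
    rewrite /gauss_step -/a; field.
    exact: frac_part_neq0.
  - by [].
  - by rewrite mulr0 mulr1 sub0r normrN.
  - by rewrite /= /cf_quot /= divr1.
  - by move=> x1; rewrite gtz0_ge1 /a floor_ge_int.
have yirr := irrational_gauss_step xirr.
have y1 := gauss_step_gt1 xirr.
have [z [p [q [p' [q' [[z1 yE] [q0 q'0] det cfE]]]]]] := IH _ yirr.
case=> [|p0 p'0]; first exact: ltW.
exists z, (a * p + q), p, (a * p' + q'), p'; split.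
- split=> //; have den0 : q%:~R * z + q'%:~R != 0 :> R.
    rewrite gt_eqF // ltr_wpDr ?ler0z // mulr_gt0 ?ltr0z //; lra.
  have num0 : p%:~R * z + p'%:~R != 0 :> R.
    rewrite gt_eqF // ltr_wpDr ?ler0z // mulr_gt0 ?ltr0z //; lra.
  have : (x - a%:~R) * (p%:~R * z + p'%:~R) = q%:~R * z + q'%:~R.
    rewrite -yE mulrA /gauss_step -/a mulfV ?mul1r //.
    exact: frac_part_neq0.
  rewrite !intrD !intrM; lra.
- by [].
- rewrite -det -normrN; congr `|_|; ring.
- rewrite /= cf_quotS cfE invf_div intrD intrM mulrDl mulfK //.
  by rewrite intr_eq0 gt_eqF.
- move=> x1; have a1 : 1 <= a by rewrite /a floor_ge_int.
  split; nia.
Qed.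

(** From [x * (q z + q') = p z + p'] and the unit determinant, the distance
    from [x] to [p / q] is [1 / (q (q z + q'))], and [q z + q' > q]. *)
Lemma cf_denom_approx (R : realType) (x : R) n : irrational x ->
  (0 < cf_denom x n)%N /\ exists p : int,
  `|x - p%:~R / (cf_denom x n)%:R| * (cf_denom x n)%:R ^+ 2 < 1.
Proof.
move=> /(@cf_eval_moebius _ _ n)[z [p [q [p' [q' [[z1 xE] [q0 q'0] det cfE _]]]]]].
have copr : coprime `|p| `|q|.
  apply/(@coprimezP p q); case: (ger0P (p * q' - p' * q)) det => _ det.
    by exists (q', - p') => /=; lia.
  by exists (- q', p') => /=; lia.
have dE : cf_denom x n = `|q|%N.
  by rewrite /cf_denom cfE coprimeq_den // gt_eqF //= absz_nat.
have qR : (cf_denom x n)%:R = q%:~R :> R.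
  by rewrite dE natr_absz ger0_norm // ltW.
split; first by rewrite dE absz_gt0 gt_eqF.
exists p; rewrite qR; have qr0 : 0 < q%:~R :> R by rewrite ltr0z.
set w := q%:~R * z + q'%:~R in xE.
have qw : q%:~R < w.
  by rewrite /w ltr_wpDr ?ler0z // -[ltLHS]mulr1 ltr_pM2l.
have w0 : 0 < w by apply: lt_trans qw.
have detR : `|p%:~R * q'%:~R - p'%:~R * q%:~R| = 1 :> R.
  by rewrite -!intrM -intrB -intr_norm det.
have -> : x - p%:~R / q%:~R =
    (p'%:~R * q%:~R - p%:~R * q'%:~R) / (q%:~R * w).
  have -> : x = (p%:~R * z + p'%:~R) / w by rewrite -xE mulfK ?gt_eqF.
  rewrite /w; field; rewrite -/w; apply/andP; split; rewrite gt_eqF //.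
rewrite normrM distrC detR mul1r gtr0_norm ?invr_gt0 ?mulr_gt0 //.
by rewrite mulrC ltr_pdivrMr ?mulr_gt0 // mul1r expr2 ltr_pM2l.
Qed.

(** * Badly approximable numbers and divisibility chains *)

Lemma int_dist_ge1 (R : realType) (m n : int) : m%:~R != n%:~R :> R ->
  1 <= `|m%:~R - n%:~R : R|.
Proof.
move=> mn; apply: norm_intr_ge1; last by rewrite subr_eq0.
by rewrite -intrB; exact: intr_int.
Qed.

(** The fractions with a denominator [q = T * a] divisible by [T], of height
    [q ^+ 2 / T]: two such fractions with denominators [q] and [r] differ by a
    multiple of [T / (q * r)], which is [T] times the usual gap. *)
Definition scaled_fractions (R : realType) (T : nat) : set (R * R) :=
  [set u | exists2 a : nat, (0 < a)%N & exists p : int,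
     u = (p%:~R / (T * a)%:R, T%:R * a%:R ^+ 2)].

Definition chain_fractions (R : realType) (t : nat -> nat) : set (R * R) :=
  [set u | exists n, exists p : int, u = (p%:~R / (t n)%:R, (t n)%:R)].

Arguments scaled_fractions : clear implicits.
Arguments chain_fractions : clear implicits.

Lemma scaled_fractions_spaced (R : realType) (T : nat) : (0 < T)%N ->
  well_spaced (scaled_fractions R T).
Proof.
move=> T0; split=> [_ [a a0 [p ->]] /=|].
  by rewrite -natrX -natrM ler1n muln_gt0 T0 expn_gt0 a0.
move=> _ _ [a a0 [p ->]] [b b0 [r ->]] /= uv.
have TR : 0 < T%:R :> R by rewrite ltr0n.
have aR : 0 < a%:R :> R by rewrite ltr0n.
have bR : 0 < b%:R :> R by rewrite ltr0n.
have E : p%:~R / (T * a)%:R - r%:~R / (T * b)%:R =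
    ((p * b%:Z)%:~R - (r * a%:Z)%:~R) / (T%:R * (a%:R * b%:R)) :> R.
  by rewrite !natrM !intrM; field; rewrite !gt_eqF.
have {uv}num : (p * b%:Z)%:~R != (r * a%:Z)%:~R :> R.
  apply: contra uv => /eqP n0; rewrite -subr_eq0 E n0 subrr mul0r //.
have Tab : 0 < T%:R * (a%:R * b%:R) :> R by rewrite !mulr_gt0.
rewrite E normrM normfV (gtr0_norm Tab) [leRHS]mulrA ler_pdivlMr // mul1r.
apply: (@le_trans _ _ (Num.max (T%:R * a%:R ^+ 2) (T%:R * b%:R ^+ 2))).
  rewrite -maxr_pMr ?(ltW TR) // ler_pM2l // le_max.
  by case: (leP (a%:R : R) b%:R) => [ab|/ltW ba]; rewrite !expr2;
    rewrite ?(ler_wpM2r (ltW bR) ab) ?(ler_wpM2l (ltW aR) ba) ?orbT.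
by rewrite ler_peMr ?int_dist_ge1 // le_max mulr_ge0.
Qed.

(** By divisibility, fractions over [t m] with [m <= n] are also fractions
    over [t n]: up to a given height, all the points lie in one arithmetic
    progression, however many terms of [t] there are below that height. *)
Lemma chain_fractions_spaced (R : realType) (t : nat -> nat) :
  (forall n, (0 < t n)%N) -> (forall m n, (m <= n)%N -> (t m %| t n)%N) ->
  well_spaced (chain_fractions R t).
Proof.
move=> t0 tdvd; split=> [_ [n [p ->]] /=|]; first by rewrite ler1n.
have lift m n (p : int) : (m <= n)%N ->
    exists r : int, p%:~R / (t m)%:R = r%:~R / (t n)%:R :> R.
  move=> /tdvd/dvdnP[k tE]; exists (p * k%:Z).
  have k0 : (0 < k)%N by case: k tE (t0 n) => // ->.
  by rewrite tE natrM intrM; field; rewrite !pnatr_eq0 -!lt0n k0 t0.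
move=> _ _ [m [p ->]] [n [r ->]] /= uv; set M := maxn m n.
have [p' pE] := lift _ M p (leq_maxl m n).
have [r' rE] := lift _ M r (leq_maxr m n).
have tM : 0 < (t M)%:R :> R by rewrite ltr0n.
have -> : Num.max (t m)%:R (t n)%:R = (t M)%:R :> R.
  have tle k l : (k <= l)%N -> (t k)%:R <= (t l)%:R :> R.
    by move=> kl; rewrite ler_nat dvdn_leq // tdvd.
  rewrite /M; case: (leqP m n) => mn; first by apply/max_idPr/tle.
  by apply/max_idPl/tle/ltnW.
have E : p%:~R / (t m)%:R - r%:~R / (t n)%:R =
    (p'%:~R - r'%:~R) / (t M)%:R :> R by rewrite pE rE mulrBl.
rewrite E normrM normfV (gtr0_norm tM) mulrC divfK ?gt_eqF //.
apply: int_dist_ge1; apply: contra uv => /eqP h.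
by rewrite -subr_eq0 E h subrr mul0r.
Qed.

Lemma dist_int_ge (R : realType) (x e : R) :
  (forall m : int, e <= `|x - m%:~R|) -> e <= dist_int x.
Proof.
move=> H; apply: lb_le_inf; first by exists `|x - 0%:~R|, 0.
by move=> _ [m _ <-].
Qed.

Lemma absD_ge (R : realType) (d : nat -> nat) (q M : nat) :
  (forall n, (tD d n %| q)%N -> (tD d n <= M)%N) -> (0 < M)%N ->
  (forall n, (0 < tD d n)%N) -> M%:R^-1 <= absD R d q.
Proof.
move=> H M0 t0; apply: lb_le_inf.
  by exists (tD d 0)%:R^-1, 0%N; rewrite //= /tD big_geq.
move=> _ [n /= /H nM <-].
by rewrite lef_pV2 ?posrE ?ltr0n // ler_nat.
Qed.

Section Divisors.
Variables (R : realType) (d : nat -> nat).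
Hypothesis hd : forall k : nat, (1 <= k)%N -> (2 <= d k)%N.

Lemma tDS n : tD d n.+1 = (tD d n * d n.+1)%N.
Proof. by rewrite /tD big_nat_recr. Qed.

Lemma tD_gt0 n : (0 < tD d n)%N.
Proof.
elim: n => [|n IH]; first by rewrite /tD big_geq.
by rewrite tDS muln_gt0 IH (ltn_trans _ (hd (ltn0Sn n))).
Qed.

Lemma tD_dvd m n : (m <= n)%N -> (tD d m %| tD d n)%N.
Proof.
elim: n => [|n IH]; first by rewrite leqn0 => /eqP ->.
rewrite leq_eqVlt => /predU1P[-> //|/IH mn].
by rewrite tDS dvdn_mulr.
Qed.

Lemma tD_le m n : (m <= n)%N -> (tD d m <= tD d n)%N.
Proof. by move=> mn; rewrite dvdn_leq ?tD_gt0 ?tD_dvd. Qed.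

Lemma tD_gt n : (n < tD d n)%N.
Proof.
elim: n => [|n IH]; first exact: tD_gt0.
have := hd (ltn0Sn n); rewrite tDS; nia.
Qed.

(** Staying away from all fractions gives [Bad], and from those over the
    [t_n] the last condition, as [t_n * |t_n| = 1]. The last hypothesis
    keeps [x] at distance at least [1 / q ^+ 2] from the fractions with a
    denominator [q] divisible by [t_M], because [c * t_M >= 1]. So such a [q]
    is not the denominator of a convergent, hence [|q_n| >= 1 / t_M], and the
    middle condition follows from [Bad]. *)
Lemma mixedBad_of_avoid (c : R) (M : nat) (x : R) :
  0 < c -> 1 <= c * (tD d M)%:R ->
  (forall u, scaled_fractions R 1 u -> c <= u.2 * `|x - u.1|) ->
  (forall u, chain_fractions R (tD d) u -> c <= u.2 * `|x - u.1|) ->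
  (forall u, scaled_fractions R (tD d M) u -> c <= u.2 * `|x - u.1|) ->
  mixedBad d x.
Proof.
move=> c0 cT avQ avt avT; set T := tD d M in cT avT.
have T0 : (0 < T)%N by exact: tD_gt0.
have mulq (q : nat) (m : int) : (0 < q)%N ->
    `|q%:R * x - m%:~R| = q%:R * `|x - m%:~R / q%:R|.
  move=> q0; rewrite -{2}[q%:R]ger0_norm // -normrM mulrBr mulrC.
  by rewrite [_ * (_ / _)]mulrC divfK // pnatr_eq0 -lt0n.
have bad q : (0 < q)%N -> c <= q%:R * dist_int (q%:R * x).
  move=> q0; rewrite mulrC -ler_pdivrMr ?ltr0n //; apply: dist_int_ge => m.
  rewrite mulq // ler_pdivrMr ?ltr0n // mulrAC -expr2 -[_ ^+ 2]mul1r.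
  apply: (avQ (m%:~R / q%:R, 1 * q%:R ^+ 2)).
  by exists q => //; exists m; rewrite mul1n.
have irr : irrational x.
  move=> p q q0; apply/eqP => E.
  have := bad `|q|%N; rewrite absz_gt0 => /(_ q0); rewrite leNgt => /negP; apply.
  apply: le_lt_trans c0; rewrite pmulr_rle0 ?ltr0n ?absz_gt0 //.
  (* |q| x is the integer m *)
  pose m := if 0 <= q then p else - p.
  apply: (le_trans (ge_inf _ (x := 0) _)) => //.
    by exists 0 => _ [k _ <-].
  exists m => //; rewrite natr_absz /m; case: (ger0P q) => _.
    by rewrite E subrr normr0.
  by rewrite !intrN mulNr E subrr normr0.
split.
- exists (c / 2) => [|q q1]; first lra.
  have q0 : 0 < q%:R :> R by rewrite ltr0n.
  by rewrite ltr_pdivrMr // [ltRHS]mulrC (lt_le_trans _ (bad q q1)) //; lra.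
- apply: (@lt_le_trans _ _ (c / T%:R)); first by rewrite divr_gt0 ?ltr0n.
  apply: lb_le_inf; first by eexists; exists 1%N.
  move=> _ [n /= n1 <-]; set q := cf_denom x n.
  have [q0 [p pq]] := cf_denom_approx n irr; rewrite -/q in q0 pq.
  rewrite mulrAC; apply: ler_pM (bad q q0) _; [exact: ltW|by []|].
  apply: absD_ge => //; last exact: tD_gt0.
  move=> k kq; apply: tD_le; rewrite leqNgt; apply/negP => /ltnW Mk.
  have /dvdnP[a qE] : (T %| q)%N by apply: dvdn_trans kq; exact: tD_dvd.
  have a0 : (0 < a)%N by case: a qE q0 => // ->.
  have cq : c <= T%:R * a%:R ^+ 2 * `|x - p%:~R / q%:R|.
    apply: (avT (p%:~R / q%:R, T%:R * a%:R ^+ 2)).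
    by exists a => //; exists p; rewrite qE mulnC.
  move: pq; rewrite ltNge => /negP; apply; apply: le_trans cT _.
  rewrite mulrC [leRHS]mulrC (_ : q%:R ^+ 2 = T%:R * (T%:R * a%:R ^+ 2) :> R).
    by rewrite -mulrA ler_pM2l ?ltr0n.
  by rewrite qE natrM; ring.
- apply: (lt_le_trans c0).
  apply: lb_le_inf; first by eexists; exists 1%N.
  move=> _ [n /= n1 <-]; have t0 := tD_gt0 n.
  rewrite -[leLHS]mul1r; apply: ler_pM => //; first exact: ltW.
    rewrite -ler_pdivrMl ?ltr0n // mulr1; apply: absD_ge => //.
      by move=> k /dvdn_leq; apply.
    exact: tD_gt0.
  apply: dist_int_ge => m; rewrite mulq //.
  by apply: (avt (m%:~R / (tD d n)%:R, (tD d n)%:R)); exists n, m.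
Qed.

Theorem winning_mixedBad : winning (2^-1 : R) (mixedBad d).
Proof.
move=> beta be; set c := avoid_const beta 3.
have c0 : 0 < c by exact: stage_len_gt0.
pose M := Num.bound c^-1.
have cT : 1 <= c * (tD d M)%:R.
  rewrite -ler_pdivrMl // mulr1 ltW // (lt_le_trans (archi_boundP _)) //.
    by rewrite invr_ge0 ltW.
  by rewrite ler_nat ltnW // tD_gt.
pose F i := match i with
  | 0 => scaled_fractions R 1 | 1 => chain_fractions R (tD d)
  | _ => scaled_fractions R (tD d M) end.
have Fsp i : (i < 3)%N -> well_spaced (F i).
  case: i => [|[|i]] _ /=.
  - exact: scaled_fractions_spaced.
  - by apply: chain_fractions_spaced; [exact: tD_gt0|exact: tD_dvd].
  - by apply: scaled_fractions_spaced; exact: tD_gt0.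
apply: winning2_sub (winning2_avoid_well_spaced be Fsp) => x xav.
apply: (@mixedBad_of_avoid c M) => // u Fu.
- exact: (xav 0%N).
- exact: (xav 1%N).
- exact: (xav 2%N).
Qed.

End Divisors.

(** * Hausdorff measure and dimension *)

Lemma diam_ge0 (R : realType) (U : set R) : (0 <= diam U)%E.
Proof. by apply: ereal_sup_ubound; left. Qed.

Lemma diam_ge (R : realType) (U : set R) x y : U x -> U y ->
  (`|x - y|%:E <= diam U)%E.
Proof. by move=> Ux Uy; apply: ereal_sup_ubound; right; exists (x, y). Qed.

Lemma diam_le (R : realType) (U : set R) (h : R) : 0 <= h ->
  (forall x y, U x -> U y -> `|x - y| <= h) -> (diam U <= h%:E)%E.
Proof.
move=> h0 H; apply: ge_ereal_sup => _ [->|[[x y] [/= Ux Uy] <-]].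
  by rewrite lee_fin.
by rewrite lee_fin H.
Qed.

Lemma diam_pow_ge0 (R : realType) (s : R) (U : set R) : (0 <= diam_pow s U)%E.
Proof. by rewrite /diam_pow; case: ifP => // _; exact: poweR_ge0. Qed.

(** Mass distribution principle, for the mass on [E] carried over by [g] from
    the length on the half-open unit interval: a set of diameter [r] pulls
    back to a subset of an interval of length [2 * C * r `^ s], and countably
    many intervals that cover the unit interval have total length at least
    1. *)
Lemma hausdorff_measure_holder (R : realType) (s C : R) (E : set R)
    (g : R -> R) :
  0 <= s -> 0 < C -> (forall y, 0 <= y < 1 -> E (g y)) ->
  (forall y z, 0 <= y < 1 -> 0 <= z < 1 ->
     `|y - z| <= C * `|g y - g z| `^ s) ->
  (0 < hausdorff_measure s E)%E.
Proof.
move=> s0 C0 gE gH.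
suff : ((2 * C)^-1%:E <= hausdorff_delta s 1 E)%E.
  move=> h; apply: (@lt_le_trans _ _ (2 * C)^-1%:E).
    by rewrite lte_fin invr_gt0 mulr_gt0.
  by apply: le_trans h _; apply: ereal_sup_ubound; exists 1 => //=.
apply: le_ereal_inf_tmp => _ [U [EU Ud] <-].
pose V k := [set y : R | 0 <= y < 1 /\ U k (g y)].
pose r k : R := C * fine (diam (U k)) `^ s.
have diam_fin k : diam (U k) = (fine (diam (U k)))%:E.
  rewrite fineK // ge0_fin_numE ?diam_ge0 //.
  by apply: le_lt_trans (Ud k) _; exact: ltry.
have /choice[y0 y0V] : forall k, exists y0, V k !=set0 -> V k y0.
  move=> k; case: (pselect (V k !=set0)) => [[y Vy]|nV]; first by exists y.
  by exists 0.
pose J k : set R :=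
  if `[< V k !=set0 >] then `[y0 k - r k, y0 k + r k]%classic else set0.
have Jm k : measurable (J k) by rewrite /J; case: ifP.
have VJ : `[0 : R, 1[%classic `<=` \bigcup_k J k.
  move=> y; rewrite /= in_itv /= => y01.
  have [k _ Uk] := EU _ (gE y y01); exists k => //.
  have Vy : V k y by [].
  have nV : V k !=set0 by exists y.
  rewrite /J asboolT //= in_itv /=.
  have [z01 Uz] := y0V k nV.
  suff : `|y - y0 k| <= r k by rewrite ler_norml; lra.
  apply: le_trans (gH _ _ y01 z01) _; rewrite ler_pM2l //.
  apply: ge0_ler_powR; rewrite ?nnegrE // ?fine_ge0 ?diam_ge0 //.
  by rewrite -lee_fin -diam_fin diam_ge.
have h : (1%:E <= \sum_(0 <= k <oo) lebesgue_measure (J k))%E.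
  have -> : 1%:E = lebesgue_measure (`[0 : R, 1[%classic : set R).
    by rewrite lebesgue_measure_itv /= lte_fin ltr01 oppr0 adde0.
  by apply: measure_sigma_subadditive => //; exact: measurable_itv.
rewrite -(@lee_pmul2l _ (2 * C)%:E) ?lte_fin ?mulr_gt0 //.
rewrite -EFinM divff ?gt_eqF ?mulr_gt0 //; apply: le_trans h _.
rewrite -nneseriesZl; last by move=> ? _; exact: diam_pow_ge0.
apply: lee_nneseries => [k _ _|k _]; first exact: measure_ge0.
rewrite /J; case: ifPn => [/asboolP[y [_ Uy]]|_]; last first.
  by rewrite measure0 mule_ge0 ?diam_pow_ge0 // lee_fin mulr_ge0 ?ltW.
have -> : diam_pow s (U k) = (fine (diam (U k)) `^ s)%:E.
  rewrite /diam_pow ifF; first by rewrite {1}diam_fin poweR_EFin.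
  by apply/eqP => U0; rewrite U0 in Uy.
rewrite lebesgue_measure_itv /= -EFinM -mulrA -/(r k) lte_fin.
have r0 : 0 <= r k by rewrite mulr_ge0 ?powR_ge0 // ltW.
by case: ifP => _; rewrite -?EFinB lee_fin; lra.
Qed.

(** * Winning sets have positive measure in every exponent below one *)

(** With [beta = 1 / (2 * N)], the intervals [child beta j I] with [j < N] are
    legal moves of [B] in [I], and every other slot of length
    [beta * itvlen I] is left empty to separate them. *)
Definition child {R : realType} (beta : R) (j : nat) (I : R * R) : R * R :=
  (I.1 + (2 * j)%:R * (beta * itvlen I),
   I.1 + (2 * j).+1%:R * (beta * itvlen I)).

Section Branching.
Variables (R : realType) (alpha : R) (N : nat) (s : seq (R * R) -> R * R).
Let beta : R := (2 * N)%:R^-1.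
Hypotheses (al : 0 < alpha < 1) (N0 : (0 < N)%N).

Lemma child_len j (I : R * R) : itvlen (child beta j I) = beta * itvlen I.
Proof. by rewrite {1}/itvlen /child /= -addn1 natrD; ring. Qed.

Lemma child_sub j (I : R * R) : (j < N)%N -> 0 <= itvlen I ->
  itvset (child beta j I) `<=` itvset I.
Proof.
move=> jN I0; have b0 : 0 <= beta by rewrite invr_ge0.
have w0 : 0 <= beta * itvlen I by rewrite mulr_ge0.
apply/itvset_subP.
  have := child_len j I; rewrite {1}/itvlen; lra.
split; rewrite /child /=; first by rewrite lerDl mulr_ge0.
rewrite -lerBrDl -/(itvlen I) mulrA -[leRHS]mul1r ler_wpM2r //.
by rewrite /beta ler_pdivrMr ?ltr0n ?muln_gt0 // mul1r ler_nat; lia.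
Qed.

Lemma child_far i j (I : R * R) x y : i != j -> 0 <= itvlen I ->
  itvset (child beta i I) x -> itvset (child beta j I) y ->
  beta * itvlen I <= `|x - y|.
Proof.
move=> ij I0; have b0 : 0 <= beta by rewrite invr_ge0.
have w0 : 0 <= beta * itvlen I by rewrite mulr_ge0.
wlog lij : i j x y {ij} / (i < j)%N => [H|].
  move: ij; rewrite neq_ltn => /orP[lij|lij] hx hy; first exact: (H i j).
  by rewrite distrC; apply: (H j i).
rewrite /itvset /child /= !in_itv /= => /andP[_ x2] /andP[y1 _].
set w := beta * _ in w0 x2 y1 *; rewrite ler0_norm.
  have : (2 * i).+2%:R * w <= (2 * j)%:R * w.
    by rewrite ler_wpM2r // ler_nat; lia.
  move: x2; rewrite -!natr1; lra.
have : (2 * i).+1%:R * w <= (2 * j)%:R * w.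
  by rewrite ler_wpM2r // ler_nat; lia.
lra.
Qed.

(** The moves of [B] up to round [n] when [B] answers in the child prescribed
    by [e] and [A] follows the strategy [s]. *)
Fixpoint branch (e : nat -> nat) (n : nat) : seq (R * R) :=
  if n is n'.+1 then
    let h := branch e n' in rcons h (child beta (e n') (s h))
  else [:: (0, beta)].

Definition branchB (e : nat -> nat) (n : nat) : R * R :=
  last (0, 0) (branch e n).

Lemma mkseq_branchB e n : mkseq (branchB e) n.+1 = branch e n.
Proof.
elim: n => [//|n IH]; rewrite mkseqS IH.
by rewrite {1}/branchB /= last_rcons.
Qed.

Lemma eq_branch e e' n : (forall k, (k < n)%N -> e k = e' k) ->
  branch e n = branch e' n.
Proof.
elim: n => [//|n IH] ee /=; rewrite ee // IH // => k kn.
by apply: ee; exact: leqW.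
Qed.

Variable Y : set R.
Hypothesis win : forall Bs : nat -> R * R,
  let As := fun n => s (mkseq Bs n.+1) in
  (forall n, (forall m, (m <= n)%N -> legalB beta As Bs m) ->
     legalA alpha As Bs n) /\
  ((forall n, legalB beta As Bs n) ->
     exists2 x : R, \bigcap_n itvset (As n) = [set x] & Y x).
Hypothesis be : 0 < beta < 1.

Let branchA e n := s (mkseq (branchB e) n.+1).

Lemma branch_legal e : (forall n, (e n < N)%N) ->
  (forall n, legalB beta (branchA e) (branchB e) n) /\
  (forall n, legalA alpha (branchA e) (branchB e) n).
Proof.
move=> eN; suff lB n : legalB beta (branchA e) (branchB e) n.
  by split=> // n; apply: (win (branchB e)).1.
elim/ltn_ind: n => -[_|n IH]; first by rewrite /= /itvlen subr0.
have BE : branchB e n.+1 = child beta (e n) (branchA e n).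
  by rewrite /branchB /branchA mkseq_branchB /= last_rcons.
have lA k : (k <= n)%N -> legalA alpha (branchA e) (branchB e) k.
  move=> kn; apply: (win (branchB e)).1 => m mk; apply: IH.
  exact: leq_ltn_trans (leq_trans mk kn) _.
rewrite /= BE child_len; split=> //; apply: child_sub => //.
have [a0 _] := andP al; have [b0 _] := andP be.
rewrite (lA n _).2 // ltW // mulr_gt0 //.
rewrite (play_len (alpha := alpha) (beta := beta) (As := branchA e)).
- by rewrite mulr_gt0 ?exprn_gt0 ?mulr_gt0.
- by move=> m mn; apply: IH.
- by move=> m /ltnW mn; apply: lA.
Qed.

(** Letting [B] choose among [N] children in each round yields a Cantor set in
    [Y]. Plays that first differ at round [k] end in different children of the
    same interval [A_k], and the gap between these bounds the distance of
    their outcomes from below. *)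
Lemma branch_points : exists G : (nat -> nat) -> R,
  (forall e, (forall n, (e n < N)%N) -> Y (G e)) /\
  (forall e e' k, (forall n, (e n < N)%N) -> (forall n, (e' n < N)%N) ->
     (forall j, (j < k)%N -> e j = e' j) -> e k != e' k ->
     beta * (alpha * beta) ^+ k.+1 <= `|G e - G e'|).
Proof.
have /choice[G GP] : forall e, exists x, (forall n, (e n < N)%N) ->
    Y x /\ forall n, itvset (branchB e n) x.
  move=> e; have [eN|] := pselect (forall n, (e n < N)%N); last by exists 0.
  have [lB lA] := branch_legal eN.
  have [x xE Yx] := (win (branchB e)).2 lB; exists x => _; split=> // n.
  apply: (lA n).1; have : [set x] x by [].
  by rewrite -xE; apply.
exists G; split=> [e eN|e e' k eN e'N ee' ek]; first exact: (GP e eN).1.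
have [lB lA] := branch_legal eN.
have [_ xB] := GP e eN; have [_ yB] := GP e' e'N.
have BE f : branchB f k.+1 = child beta (f k) (s (branch f k)).
  by rewrite /branchB /= last_rcons.
have := xB k.+1; have := yB k.+1; rewrite !BE -(eq_branch ee').
have := play_lenA lB lA k; rewrite /branchA mkseq_branchB => len y1 x1.
have := child_far ek _ x1 y1; rewrite len.
have [a0 _] := andP al; have [b0 _] := andP be.
by rewrite exprS; apply; rewrite ltW // mulr_gt0 ?exprn_gt0 ?mulr_gt0.
Qed.

End Branching.

Definition digit {R : realType} (N : nat) (y : R) (k : nat) : nat :=
  (Num.truncn (y * N%:R ^+ k.+1) %% N)%N.

Lemma truncn_mul_div (R : realType) (N : nat) (y : R) : (0 < N)%N -> 0 <= y ->
  (Num.truncn (y * N%:R) %/ N)%N = Num.truncn y.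
Proof.
move=> N0 y0; apply/esym/truncn_def; set m := Num.truncn _.
have NR : 0 < N%:R :> R by rewrite ltr0n.
have /andP[m1 m2] : m%:R <= y * N%:R < m.+1%:R.
  by apply: truncn_itv; rewrite mulr_ge0.
apply/andP; split.
  rewrite -(ler_pM2r NR); apply: le_trans m1.
  by rewrite -natrM ler_nat leq_trunc_div.
rewrite -(ltr_pM2r NR); apply: lt_le_trans m2 _.
by rewrite -natrM ler_nat ltn_ceil.
Qed.

Lemma truncn_eq_dist (R : realType) (c y z : R) : 0 < c -> 0 <= y -> 0 <= z ->
  Num.truncn (y * c) = Num.truncn (z * c) -> `|y - z| <= c^-1.
Proof.
move=> c0 y0 z0 yz.
have := truncn_itv (mulr_ge0 y0 (ltW c0)).
have := truncn_itv (mulr_ge0 z0 (ltW c0)).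
rewrite -yz; set m := Num.truncn _; rewrite -natr1 => /andP[? ?] /andP[? ?].
rewrite -(ler_pM2r c0) mulVf ?gt_eqF // -[X in _ * X](gtr0_norm c0) -normrM.
by rewrite ler_norml; apply/andP; split; lra.
Qed.

(** The rank [k] of the first different digit is one less than the first
    exponent for which the integral parts of [y * N ^+ k] and [z * N ^+ k]
    differ; those at rank [k] agree, which bounds the distance. *)
Lemma digit_sep (R : realType) (N : nat) (y z : R) : (1 < N)%N ->
  0 <= y < 1 -> 0 <= z < 1 -> y != z ->
  exists k, [/\ forall j, (j < k)%N -> digit N y j = digit N z j,
                digit N y k != digit N z k & `|y - z| <= N%:R ^- k].
Proof.
move=> N1 /andP[y0 y1] /andP[z0 z1] yz; have N0 := ltnW N1.
have NR k : 0 < N%:R ^+ k :> R by rewrite exprn_gt0 ?ltr0n.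
pose t k (x : R) := Num.truncn (x * N%:R ^+ k).
have tS k x : 0 <= x -> t k.+1 x = (t k x * N + digit N x k)%N.
  move=> x0; rewrite /digit -/(t k.+1 x) {1}(divn_eq (t k.+1 x) N).
  rewrite /t exprSr mulrA truncn_mul_div //.
  by rewrite mulr_ge0 // ltW.
have diff : exists k, t k y != t k z.
  have [||k] := @exp_lt_eps _ 1 N%:R^-1 `|y - z|.
    by rewrite invr_ge0 ler0n /= invf_lt1 ?ltr0n // ltr1n.
    by rewrite normr_gt0 subr_eq0.
  rewrite mul1r exprVn => h; exists k; apply/eqP => tk.
  by have := truncn_eq_dist (NR k) y0 z0 tk; rewrite leNgt h.
case: (ex_minnP diff) => -[|k] tk kmin.
  have t0 x : 0 <= x < 1 -> t 0%N x = 0%N.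
    by move=> x01; rewrite /t expr0 mulr1; exact: truncn_def.
  by move: tk; rewrite !t0 ?y0 ?z0.
have teq j : (j <= k)%N -> t j y = t j z.
  move=> jk; apply/eqP/negPn/negP => /kmin; rewrite ltnNge jk //.
exists k; split=> [j jk||].
- by rewrite /digit -/(t j.+1 y) -/(t j.+1 z) teq.
- by apply: contra tk => /eqP dk; rewrite !tS // dk teq.
- by apply: truncn_eq_dist => //; exact: teq.
Qed.

Lemma powR_exprn (R : realType) (x s : R) n : 0 <= x ->
  (x ^+ n) `^ s = (x `^ s) ^+ n.
Proof.
move=> x0; elim: n => [|n IH]; first by rewrite !expr0 powR1.
by rewrite !exprS powRM ?exprn_ge0 // IH.
Qed.

(** As [N] grows, [(alpha / (2 * N)) `^ s] is [N `^ (- s)] up to a constant,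
    and [s < 1]. *)
Lemma branching_number (R : realType) (alpha s : R) : 0 < alpha ->
  0 <= s < 1 ->
  exists2 N, (1 < N)%N & N%:R^-1 <= (alpha * (2 * N)%:R^-1) `^ s.
Proof.
move=> a0 /andP[s0 s1]; have s10 : 0 < 1 - s by lra.
pose t := (2 / alpha) `^ s.
pose N := (Num.bound (t `^ (1 - s)^-1)).+2; exists N => //.
have NR : 0 < N%:R :> R by rewrite ltr0n.
have tN : t <= N%:R `^ (1 - s).
  have -> : t = (t `^ (1 - s)^-1) `^ (1 - s).
    by rewrite -powRrM mulVf ?gt_eqF // powRr1 ?powR_ge0.
  apply: ge0_ler_powR; rewrite ?nnegrE ?powR_ge0 ?ltW //.
  apply: lt_le_trans (archi_boundP (powR_ge0 _ _)) _.
  by rewrite ler_nat /N ltnW.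
have -> : alpha * (2 * N)%:R^-1 = (2 / alpha * N%:R)^-1.
  by rewrite natrM; field; rewrite !gt_eqF.
have X0 : 0 < 2 / alpha * N%:R by rewrite mulr_gt0 ?divr_gt0.
rewrite -[X in X `^ s]powR_inv1 ?(ltW X0) // -powRrM [-1 * s]mulrC powRrM.
rewrite powR_inv1 ?powR_ge0 // lef_pV2 ?posrE ?powR_gt0 //.
rewrite powRM ?divr_ge0 ?(ltW a0) // -/t.
have {2}-> : N%:R = N%:R `^ (1 - s) * N%:R `^ s :> R.
  by rewrite -powRD ?subrK ?powRr1 // gt_eqF ?implybT.
by rewrite ler_wpM2r ?powR_ge0.
Qed.

(** The outcomes [G] of the plays of [B], indexed by the base [N] digits of
    [y], form an inverse-Holder family: if the digits of [y] and [z]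
    first differ at rank [k], then [y] and [z] are within [N ^- k], while the
    outcomes are at least [beta * (alpha * beta) ^+ k.+1] apart, and
    [(alpha * beta) `^ s >= 1 / N]. *)
Theorem winning_hausdorff_measure (R : realType) (alpha s : R) (Y : set R) :
  0 < alpha < 1 -> winning alpha Y -> 0 <= s < 1 ->
  (0 < hausdorff_measure s Y)%E.
Proof.
move=> al winY s01; have [a0 a1] := andP al; have [s0 s1] := andP s01.
have [N N1 NP] := branching_number a0 s01; have N0 := ltnW N1.
have NR : 0 < N%:R :> R by rewrite ltr0n.
set beta := (2 * N)%:R^-1 in NP.
have be : 0 < beta < 1.
  by rewrite invr_gt0 ltr0n muln_gt0 N0 invf_lt1 ?ltr0n ?ltr1n; lia.
have [b0 b1] := andP be; have bs : 0 < beta `^ s by exact: powR_gt0.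
have [str win] := winY _ be.
have [G [GY Gfar]] := branch_points al N0 win be.
have dN (y : R) n : (digit N y n < N)%N by rewrite /digit ltn_mod.
apply: (@hausdorff_measure_holder _ s (N%:R / beta `^ s) Y
          (fun y => G (digit N y))) => //.
- by rewrite divr_gt0.
- by move=> y _; exact/GY/dN.
move=> y z y01 z01; have [->|yz] := eqVneq y z.
  by rewrite subrr normr0 mulr_ge0 ?powR_ge0 // divr_ge0 ?ltW.
have [k [ee ek]] := digit_sep N1 y01 z01 yz; move/le_trans; apply.
have := Gfar _ _ _ (dN y) (dN z) ee ek; set D := `|_| => kD.
have ab0 : 0 <= alpha * beta by rewrite mulr_ge0 ?ltW.
apply: (@le_trans _ _
  (N%:R / beta `^ s * (beta * (alpha * beta) ^+ k.+1) `^ s)); last first.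
  rewrite ler_pM2l ?divr_gt0 //; apply: ge0_ler_powR => //; rewrite ?nnegrE.
    by rewrite mulr_ge0 ?exprn_ge0 ?(ltW b0).
  exact: normr_ge0.
rewrite powRM ?exprn_ge0 ?(ltW b0) // mulrA divfK ?gt_eqF //.
rewrite powR_exprn // -exprVn.
apply: (@le_trans _ _ (N%:R * N%:R^-1 ^+ k.+1)).
  by rewrite exprS mulrA mulfV ?mul1r // gt_eqF.
by rewrite ler_pM2l // lerXn2r ?nnegrE ?invr_ge0 ?powR_ge0 ?ler0n.
Qed.

(** * Subsets of the line have dimension at most one *)

Lemma diam_itv_le (R : realType) (a h : R) : 0 <= h ->
  (diam `[a, (a + h)%R]%classic <= h%:E)%E.
Proof.
move=> h0; apply: diam_le => // x y; rewrite /= !in_itv /=.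
by move=> /andP[? ?] /andP[? ?]; rewrite ler_norml; lra.
Qed.

Lemma diam_pow_itv_le (R : realType) (s a h : R) : 0 <= s -> 0 <= h ->
  (diam_pow s `[a, (a + h)%R]%classic <= (h `^ s)%:E)%E.
Proof.
move=> s0 h0; rewrite /diam_pow; case: ifP => _.
  by rewrite lee_fin powR_ge0.
rewrite -poweR_EFin; apply: gt0_ler_poweR => //.
- by rewrite in_itv /= diam_ge0 leey.
- by rewrite in_itv /= lee_fin h0 leey.
- exact: diam_itv_le.
Qed.

(** Cutting an interval of length [K] into [m] equal pieces costs
    [m * (K / m) `^ s], which tends to 0. *)
Lemma small_pieces (R : realType) (s K delta e : R) : 1 < s -> 0 < K ->
  0 < delta -> 0 < e -> exists m, [/\ (0 < m)%N, K / m%:R <= delta &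
    m%:R * (K / m%:R) `^ s <= e].
Proof.
move=> s1 K0 d0 e0; have s10 : 0 < s - 1 by lra.
pose r := (e / K) `^ (s - 1)^-1.
have r0 : 0 < r by rewrite powR_gt0 // divr_gt0.
pose m := (Num.bound (K / Num.min delta r)).+1; exists m.
have mR : 0 < m%:R :> R by rewrite ltr0n.
have mn0 : 0 < Num.min delta r by rewrite lt_min d0.
have : K / m%:R <= Num.min delta r.
  rewrite ler_pdivrMr // mulrC -ler_pdivrMr //.
  apply/ltW/(lt_le_trans (archi_boundP _)); first by rewrite divr_ge0 ?ltW.
  by rewrite ler_nat.
rewrite le_min => /andP[md mr]; split=> //.
have Km : 0 < K / m%:R by rewrite divr_gt0.
have -> : m%:R * (K / m%:R) `^ s = K * (K / m%:R) `^ (s - 1).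
  rewrite -(@mulr_powRB1 _ (K / m%:R)) ?ltW //; last lra.
  by rewrite mulrA mulrCA mulfV ?mulr1 // gt_eqF.
rewrite mulrC -ler_pdivlMr //.
have -> : e / K = r `^ (s - 1).
  by rewrite /r -powRrM mulVf ?gt_eqF // powRr1 // divr_ge0 ?ltW.
by apply: ge0_ler_powR => //; [|rewrite nnegrE|rewrite nnegrE]; exact: ltW.
Qed.

Lemma nneseries_ltn (R : realType) (r : R) (m : nat) : 0 <= r ->
  (\sum_(0 <= i <oo) (if (i < m)%N then r%:E else 0))%E = (m%:R * r)%:E.
Proof.
move=> r0; rewrite (nneseries_split 0 m) ?add0n; last first.
  by move=> k _; case: ifP; rewrite ?lee_fin.
rewrite [X in (_ + X)%E]eseries0 ?adde0; last first.
  by move=> i mi _; rewrite ltnNge mi.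
rewrite big_mkord (eq_bigr (fun=> r%:E)); last by move=> i _; rewrite ltn_ord.
by rewrite sumEFin sumr_const card_ord mulr_natl.
Qed.

(** The line is the union over [n] of the intervals [- n.+1, n.+1]; the [n]-th
    one is cut into pieces so small that they contribute at most
    [e / 2 ^ n.+1], and all the pieces are enumerated by [nat]. *)
Lemma hausdorff_measure_gt1 (R : realType) (s : R) (E : set R) : 1 < s ->
  hausdorff_measure s E = 0%E.
Proof.
move=> s1; have s0 : 0 <= s by lra.
suff H delta : 0 < delta -> hausdorff_delta s delta E = 0%E.
  apply/eqP; rewrite eq_le; apply/andP; split.
    by apply: ge_ereal_sup => _ [delta d0 <-]; rewrite H.
  by apply: ereal_sup_ubound; exists 1; [exact: ltr01|rewrite H].
move=> d0; apply/eqP; rewrite eq_le; apply/andP; split; last first.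
  apply: le_ereal_inf_tmp => _ [U _ <-].
  by apply: nneseries_ge0 => *; exact: diam_pow_ge0.
apply/lee_addgt0Pr => e e0; rewrite add0e.
pose K n : R := (2 * n.+1)%:R.
have K0 n : 0 < K n by rewrite ltr0n.
have /choice[m mP] : forall n, exists m, [/\ (0 < m)%N, K n / m%:R <= delta &
    m%:R * (K n / m%:R) `^ s <= e / (2 ^ n.+1)%:R].
  by move=> n; apply: small_pieces; rewrite ?divr_gt0 ?ltr0n ?expn_gt0.
pose h n : R := K n / (m n)%:R.
have h0 n : 0 < h n by have [? _ _] := mP n; rewrite divr_gt0 // ltr0n.
have /card_set_bijP[f fbij] : ([set: nat] #= [set: nat * nat])%card.
  by rewrite card_eq_sym; exact: card_nat2.
pose piece (u : nat * nat) : set R :=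
  let a := - u.1.+1%:R + u.2%:R * h u.1 in
  if (u.2 < m u.1)%N then `[a, a + h u.1]%classic else set0.
pose w n i : \bar R := if (i < m n)%N then (h n `^ s)%:E else 0%E.
have w0 n i : (0 <= w n i)%E.
  by rewrite /w; case: ifP => // _; rewrite lee_fin powR_ge0.
have piece_w u : (diam_pow s (piece u) <= w u.1 u.2)%E.
  rewrite /piece /w; case: ifP => _; last by rewrite /diam_pow eqxx.
  by apply: diam_pow_itv_le => //; exact: ltW.
apply: ge_ereal_inf; exists (\sum_(0 <= k <oo) diam_pow s (piece (f k)))%E.
  exists (fun k => piece (f k)) => //; split=> [x _|k].
    pose n := Num.bound `|x|.
    have nx : `|x| < n%:R by exact: archi_boundP.
    have hn := h0 n; have [m0 _ _] := mP n.
    pose y := (x + n.+1%:R) / h n.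
    have xn : 0 <= x + n.+1%:R.
      by move: nx; rewrite ltr_norml -natr1; lra.
    have y0 : 0 <= y by rewrite divr_ge0 // ltW.
    have := truncn_itv y0; set i := Num.truncn y => /andP[i1 i2].
    have im : (i < m n)%N.
      rewrite -(ltr_nat R); apply: le_lt_trans i1 _.
      rewrite /y ltr_pdivrMr // /h mulrC divfK ?pnatr_eq0 -?lt0n //.
      by move: nx; rewrite /K natrM ltr_norml -natr1; lra.
    have [_ _ /(_ (n, i) I)[k _ fk]] := fbij; exists k => //.
    rewrite fk /piece /= im /= in_itv /=.
    move: i1 i2; rewrite /y ler_pdivlMr // ltr_pdivrMr // -natr1; lra.
  rewrite /piece; case: ifP => [_|_]; last first.
    by apply: diam_le => [|? ?]; [exact: ltW|].
  have [_ hd _] := mP (f k).1; apply: (@le_trans _ _ (h (f k).1)%:E) => //.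
  by apply: diam_itv_le; exact: ltW.
apply: (@le_trans _ _ (\sum_(0 <= k <oo) w (f k).1 (f k).2)%E).
  by apply: lee_nneseries => k _; [move=> _; exact: diam_pow_ge0|].
rewrite nneseries_esumT //.
rewrite -(@reindex_esum _ _ _ _ [set: nat * nat] f (fun u => w u.1 u.2)) //.
have -> : [set: nat * nat] = [set: nat] `*`` (fun=> [set: nat]).
  by apply/seteqP; split.
rewrite -(@esum_esum _ _ _ _ _ w) //.
rewrite -nneseries_esumT; last by move=> n; exact: esum_ge0.
apply: le_trans (epsilon_trick0 xpredT (ltW e0)).
apply: lee_nneseries => [n _ _|n _]; first exact: esum_ge0.
rewrite -nneseries_esumT // nneseries_ltn ?powR_ge0 // lee_fin.
by have [_ _] := mP n.
Qed.

Lemma hausdorff_dim_eq1 (R : realType) (E : set R) :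
  (forall s : R, 0 <= s < 1 -> (0 < hausdorff_measure s E)%E) ->
  hausdorff_dim E = 1%E.
Proof.
move=> H; apply/eqP; rewrite eq_le; apply/andP; split.
  apply/lee_addgt0Pr => e e0; apply: ereal_inf_lbound; exists (1 + e) => //.
  by split; [lra|apply: hausdorff_measure_gt1; lra].
apply: le_ereal_inf_tmp => _ [s [s0 sE] <-]; rewrite lee_fin leNgt.
by apply/negP => s1; have := H s; rewrite s0 s1 sE ltxx => /(_ isT).
Qed.

(** * The winning property and the dimension of the mixed set *)

Theorem proposition4 (R : realType) (d : nat -> nat)
  (hd : forall k : nat, (1 <= k)%N -> (2 <= d k)%N) :
  winning (2^-1 : R) (mixedBad d : set R) /\
  hausdorff_dim (mixedBad d : set R) = 1%E.
Proof.
have win := @winning_mixedBad R d hd; split=> //.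
apply: hausdorff_dim_eq1 => s s01.
by apply: winning_hausdorff_measure win s01; apply/andP; split; lra.
Qed.
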